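(* The construction is dense for curves of degree $5$; that is, there is a nonempty Zariski-open set $U$ of degree-$5$ plane curves (a nonempty Zariski-open subset $U\subset \mathbb{P}(S_5)\cong\mathbb{P}^{20}$) such that every curve $X\in U$ is constructible.
   Context: Let $S=\mathbb{C}[x,y,z]=\bigoplus_{d\ge 0}S_d$. Degree-$d$ curves in the complex projective plane $\mathbb{P}^2$ are identified with points of the projective space $\mathbb{P}(S_d)$ (nonzero forms of degree $d$ up to nonzero scalar), equipped with the Zariski topology. A curve $X$ of degree $d$ is called constructible if there exist $d+1$ red lines $\ell_1,\dots,\ell_{d+1}$ and $d+1$ blue lines $L_1,\dots,L_{d+1}$ in $\mathbb{P}^2$ such that the $d+1$ points $\ell_i\cap L_i$ ($1\le i\le d+1$) are collinear and the other $d(d+1)$ points $\ell_i\cap L_j$ ($i\ne j$) lie on $X$; here the $(d+1)^2$ points $\ell_i\cap L_j$ are understood to be pairwise distinct. The construction is said to be dense for degree-$d$ curves if there is a nonempty Zariski-open subset $U\subset\mathbb{P}(S_d)$ such that each $X\in U$ is constructible. *)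

(* Defs.v *)
From HB Require Import structures.
From mathcomp Require Import all_boot all_order all_algebra.
From mathcomp Require Import classical_sets.
From mathcomp Require Import mpoly.

Set Implicit Arguments.
Unset Strict Implicit.
Unset Printing Implicit Defensive.

Import GRing.Theory.
Local Open Scope classical_set_scope.
Local Open Scope ring_scope.

Record grassmannian (K : fieldType) (V : vectType K) (k : nat) := Grassmannian {
  subspace_of :> {vspace V};
  _ : \dim subspace_of == k
}.
HB.instance Definition _ (K : fieldType) (V : vectType K) (k : nat) :=
  [isSub for @subspace_of K V k].

(* P(V): its points are the one-dimensional subspaces of V, that is, the
   nonzero vectors up to a nonzero scalar. *)
Definition proj_space (K : fieldType) (V : vectType K) := grassmannian V 1.

Definition plane_point (K : fieldType) := proj_space 'rV[K]_3.
(* A line of P(K^3) is the projectivization of a plane of K^3. *)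
Definition plane_line (K : fieldType) := grassmannian 'rV[K]_3 2.
(* [dhomog 3 K d] is the space of forms of degree d in three variables. *)
Definition plane_curve (K : fieldType) (d : nat) :=
  proj_space (dhomog 3 K d).

(* The homogeneous coordinates are taken in the basis [vbasis {:V}]; the
   topology does not depend on this choice, as a linear change of coordinates
   sends homogeneous polynomials to homogeneous polynomials. *)
Definition vanishes_at (K : fieldType) (V : vectType K)
    (F : {mpoly K[\dim {:V}]}) (p : proj_space V) : Prop :=
  forall v : V, v \in subspace_of p ->
    F.@[fun i => coord (vbasis {:V}) i v] = 0.

Definition zariski_closed (K : fieldType) (V : vectType K)
    (Z : set (proj_space V)) : Prop :=
  exists E : set {mpoly K[\dim {:V}]},
    (forall F, E F -> exists k : nat, F \is k.-homog) /\
    Z = [set p | forall F, E F -> vanishes_at F p].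

Definition zariski_open (K : fieldType) (V : vectType K)
    (U : set (proj_space V)) : Prop :=
  zariski_closed (~` U).

Definition on_curve (K : fieldType) (d : nat)
    (p : plane_point K) (X : plane_curve K d) : Prop :=
  forall (f : dhomog 3 K d) (v : 'rV[K]_3),
    f \in subspace_of X -> v \in subspace_of p ->
    (f : {mpoly K[3]}).@[fun i => v 0 i] = 0.

(* [P i j] is the point of intersection of the red line [l i] and the blue line
   [L j]; the first condition forces these two lines to be distinct. *)
Definition constructible (K : fieldType) (d : nat) (X : plane_curve K d) : Prop :=
  exists (l L : 'I_d.+1 -> plane_line K)
         (P : 'I_d.+1 -> 'I_d.+1 -> plane_point K),
    [/\ forall i j, subspace_of (P i j)
                    = (subspace_of (l i) :&: subspace_of (L j))%VS,
        injective (fun ij : 'I_d.+1 * 'I_d.+1 => P ij.1 ij.2),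
        exists M : plane_line K,
          forall i, (subspace_of (P i i) <= subspace_of M)%VS
      & forall i j, i != j -> on_curve (P i j) X].

(* Main.v *)
From HB Require Import structures.
Require Import Defs.
From mathcomp Require Import all_boot all_order all_algebra.
From mathcomp Require Import closed_field zify ring.
From mathcomp Require Import boolp classical_sets reals.
From mathcomp Require Import complex.
From mathcomp Require Import mpoly.

Set Implicit Arguments.
Unset Strict Implicit.
Unset Printing Implicit Defensive.

Import Order.TTheory GRing.Theory Num.Theory.
Local Open Scope classical_set_scope.
Local Open Scope ring_scope.

(** Six red forms l_i together with a form m determine the six blue forms
l_i + m, and then prod (l_i + m) - prod l_i is divisible by m.  The quotient F
is a quintic.  At a point common to the i-th red line and the j-th blue line
both products vanish, hence so does m * F: for i = j the point lies on the line
m = 0, and for i <> j it lies on F = 0 as soon as m does not vanish there.  So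
F is constructible whenever the lines are in general position, which is the
nonvanishing of one polynomial in the 7 * 3 coefficients of m and the l_i
([constructible_of_config]).

There are as many coefficients as there are monomials of degree 5, namely 21,
so the map (m, l) |-> F may be dominant, and it is.  Its differential is onto at
one well chosen configuration ([quintic_tangent_onto]): for u + v + w = 0 take
m = 2z and the red lines x - z, x - 2z with x in {u, v, w}.  The seven partial
derivatives of F are then quartics that are symmetric enough for a direct
elimination showing that their multiples by linear forms fill the space of
quintics ([tangent_span]).  If a polynomial G vanishes on the image of the map,
the lowest homogeneous part of G at the image of that configuration vanishes in
every direction, so G = 0 ([eq0_of_curves]).

Dominance alone would only give a dense image.  By quantifier elimination over
an algebraically closed field the image is defined by a quantifier-free formula,
whose truth value is constant where none of its nonzero atoms vanishes.  The
image thus contains the complement of a hypersurface, or is contained in a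
hypersurface, which dominance excludes ([generic_image]).  Finally the
equation of this hypersurface is replaced by one of its homogeneous components,
which suffices because being constructible is invariant under scaling
([constructible_dense]). *)

(** * Polynomials over an infinite field *)

Lemma poly_eq0_horner (K : numFieldType) (P : {poly K}) :
  (forall t, P.[t] = 0) -> P = 0.
Proof.
move=> P0; apply/eqP/contraT => nzP.
pose rs : seq K := [seq i%:R | i <- iota 0 (size P)].
have urs : uniq rs.
  by rewrite map_inj_uniq ?iota_uniq // => i j /eqP; rewrite eqr_nat => /eqP.
have /(max_poly_roots nzP)/(_ urs) : all (root P) rs.
  by apply/allP => t _; apply/eqP/P0.
by rewrite size_map size_iota ltnn.
Qed.

Lemma meval_muni (K : comNzRingType) n (p : {mpoly K[n.+1]}) (v : 'I_n.+1 -> K) :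
  (map_poly (meval (fun i : 'I_n => v (widen_ord (leqnSn n) i))) (muni p)).[v ord_max]
    = p.@[v].
Proof.
rewrite muniE mevalE rmorph_sum horner_sum /=.
apply: eq_bigr => m _.
rewrite map_polyZ map_polyXn /= !mevalZ mevalX hornerZ hornerXn -mulrA.
congr (_ * _); rewrite big_ord_recr /=; congr (_ * _).
by apply: eq_bigr => i _; rewrite mnmE.
Qed.

(** Induction on the number of variables: view [p] as a univariate polynomial in
its last variable, whose coefficients vanish everywhere because its values do. *)
Lemma mpoly_eq0_meval (K : numFieldType) n (p : {mpoly K[n]}) :
  (forall v, p.@[v] = 0) -> p = 0.
Proof.
elim: n p => [|n IHn] p p0; first last.
  suff mp0 : muni p = 0.
    apply/mpolyP => m; rewrite mcoeff0.
    have := congr1 (fun P : {poly {mpoly K[n]}} =>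
      (P`_(m ord_max))@_[multinom m (widen_ord (leqnSn n) i) | i < n]) mp0.
    rewrite coef0 mcoeff0 muniE coef_sum raddf_sum /= => <-.
    rewrite {1}[p]mpolyE raddf_sum /=; apply: eq_bigr => m' _.
    rewrite coefZ mcoeffZ coefXn [in RHS]mulr_natr mcoeffMn !mcoeffZ !mcoeffX.
    rewrite -mulrnAr -mulrnA mulnb; congr (_ * (nat_of_bool _)%:R).
    apply/eqP/andP => [-> // | [/eqP/mnmP eqw /eqP eqm]].
    apply/mnmP => i; have [j -> | ->] := unliftP ord_max i; last by rewrite eqm.
    have := eqw j; rewrite !mnmE.
    have -> // : widen_ord (leqnSn n) j = lift ord_max j.
      by apply/val_inj; rewrite /= /bump leqNgt ltn_ord.
  apply/polyP => k; rewrite coef0; apply: IHn => v.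
  suff P0 : map_poly (meval v) (muni p) = 0.
    by have := congr1 (fun P : {poly K} => P`_k) P0; rewrite coef_map coef0.
  apply: poly_eq0_horner => t.
  pose w (i : 'I_n.+1) := if unlift ord_max i is Some j then v j else t.
  have -> : t = w ord_max by rewrite /w unlift_none.
  rewrite -[RHS](p0 w) -meval_muni; congr (_.[_]); apply: eq_map_poly => q.
  apply: meval_eq => i; rewrite /w.
  have -> : widen_ord (leqnSn n) i = lift ord_max i.
    by apply/val_inj; rewrite /= /bump leqNgt ltn_ord.
  by rewrite liftK.
apply/mpolyP => m; rewrite mcoeff0.
have e (m' : 'X_{1..0}) : m' = 0%MM by apply/mnmP => -[].
rewrite (e m) -(p0 (fun _ => 0)) {2}[p]mpolyE raddf_sum /=.
rewrite {1}[p]mpolyE raddf_sum /=.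
apply: eq_bigr => m' _; rewrite (e m') !mevalZ mcoeffZ mpolyX0 mcoeff1 meval1.
by rewrite eqxx.
Qed.

Lemma meval_neq0 (K : numFieldType) n (p : {mpoly K[n]}) :
  p != 0 -> exists v, p.@[v] != 0.
Proof.
move=> nzp; apply: contrapT => /forallNP p0; case/eqP: nzp.
by apply: mpoly_eq0_meval => v; apply/eqP/negPn/negP; apply: p0.
Qed.

Lemma meval_dhomog (K : comNzRingType) n d (p : {mpoly K[n]}) c (v : 'I_n -> K) :
  p \is d.-homog -> p.@[fun i => c * v i] = c ^+ d * p.@[v].
Proof.
move/dhomogP => hp; rewrite !mevalE mulr_sumr !big_seq; apply: eq_bigr => m /hp dm.
rewrite mulrCA; congr (_ * _); rewrite -dm.
have -> : c ^+ mdeg m = \prod_i c ^+ m i.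
  by rewrite mdegE; apply: (big_morph (fun k => c ^+ k) (exprD c)).
by rewrite -big_split /=; apply: eq_bigr => i _; rewrite exprMn.
Qed.

Lemma meval_scaleE (K : comNzRingType) n k (p : {mpoly K[n]}) c (v : 'I_n -> K) :
  (msize p <= k)%N ->
  p.@[fun i => c * v i] = \sum_(d < k) c ^+ d * (pihomog mdeg d p).@[v].
Proof.
move=> le_pk; rewrite {1}(pihomog_partitionE le_pk) raddf_sum /=.
by apply: eq_bigr => d _; rewrite (meval_dhomog _ _ (pihomogP _ _ _)).
Qed.

(** This replaces the Jacobian criterion for dominance: if the image of a
polynomial map contains, through [y0], curves with arbitrary tangent vectors,
then it lies on no hypersurface.  Restrict [G] to the curve y0 + t * u(t) with
u(0) = w.  The coefficient of t ^ d, for d the least degree of a nonzero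
homogeneous part of [G] at [y0], is the value of that part at w. *)
Lemma eq0_of_curves (K : numFieldType) n (G : {mpoly K[n]}) (y0 : 'I_n -> K) :
  (forall w : 'I_n -> K, exists y : 'I_n -> {poly K},
     [/\ forall i, (y i)`_0 = y0 i, forall i, (y i)`_1 = w i
       & forall t, G.@[fun i => (y i).[t]] = 0]) ->
  G = 0.
Proof.
move=> curves.
(* G in coordinates centred at y0 *)
pose H := G \mPo [tuple 'X_i + (y0 i)%:MP | i < n].
have HE z : H.@[z] = G.@[fun i => z i + y0 i].
  rewrite comp_mpoly_meval; apply: meval_eq => i.
  by rewrite tnth_mktuple mevalD mevalXU mevalC.
suff Hd : forall d, pihomog mdeg d H = 0.
  apply: mpoly_eq0_meval => v.
  have -> : G.@[v] = H.@[fun i => v i - y0 i].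
    by rewrite HE; apply: meval_eq => i; rewrite subrK.
  rewrite {1}(pihomog_partitionE (leqnn (msize H))) big1 ?meval0 //.
elim/ltn_ind => d IHd; apply: mpoly_eq0_meval => w.
have [y [y_0 y_1 Gy]] := curves w.
pose u i := drop_poly 1 (y i).
have yE i t : (y i).[t] = t * (u i).[t] + y0 i.
  have -> : y i = u i * 'X + (y0 i)%:P.
    rewrite -{1}(poly_take_drop 1 (y i)) addrC expr1 -y_0; congr (_ + _).
    by apply/polyP => -[|k]; rewrite coefC coef_take_poly.
  by rewrite hornerD hornerM hornerX hornerC mulrC.
have u_0 i : (u i).[0] = w i by rewrite horner_coef0 coef_drop_poly -y_1.
pose h e := mmap polyC u (pihomog mdeg e H).
have hE e t : (h e).[t] = (pihomog mdeg e H).@[fun i => (u i).[t]].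
  rewrite /h /mmap mevalE horner_sum; apply: eq_bigr => m _.
  rewrite hornerM hornerC horner_prod; congr (_ * _).
  by apply: eq_bigr => i _; rewrite horner_exp.
pose k := maxn d.+1 (msize H).
have sum0 : \sum_(e < k) 'X^e * h e = 0.
  apply: poly_eq0_horner => t; rewrite -[RHS](Gy t) horner_sum.
  rewrite (meval_eq _ (yE^~ t)) -HE (meval_scaleE (k := k)) ?leq_maxr //.
  by apply: eq_bigr => e _; rewrite hornerM hornerXn hE.
have := congr1 (fun P : {poly K} => P`_d) sum0.
have lt_dk : (d < k)%N by rewrite leq_maxl.
rewrite coef0 coef_sum (bigD1 (Ordinal lt_dk)) //= coefXnM ltnn subnn.
rewrite -horner_coef0 hE big1 ?addr0 => [<-|e ne_ed].
  by apply: meval_eq => i; rewrite u_0.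
rewrite coefXnM; case: ltnP => // le_ed.
have /IHd eq0 : (e < d)%N by rewrite ltn_neqAle le_ed andbT.
by rewrite /h eq0 mmap0 coef0.
Qed.

(** * The image of a dominant map contains a nonempty open set *)

Section GenericTruth.
Variables (K : numFieldType) (n : nat).

(** Inverses never occur in the terms to which this is applied, and variables
beyond the first [n] evaluate to the default value 0. *)
Fixpoint mpoly_of_term (t : GRing.term K) : {mpoly K[n]} :=
  match t with
  | GRing.Var i => if insub i is Some j then 'X_j else 0
  | GRing.Const c => c%:MP
  | GRing.NatConst k => k%:R
  | GRing.Add t1 t2 => mpoly_of_term t1 + mpoly_of_term t2
  | GRing.Opp t1 => - mpoly_of_term t1
  | GRing.NatMul t1 k => mpoly_of_term t1 *+ k
  | GRing.Mul t1 t2 => mpoly_of_term t1 * mpoly_of_term t2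
  | GRing.Inv _ => 0
  | GRing.Exp t1 k => mpoly_of_term t1 ^+ k
  end.

Lemma meval_mpoly_of_term (y : 'I_n -> K) t : GRing.rterm t ->
  (mpoly_of_term t).@[y] = GRing.eval [tuple y i | i < n] t.
Proof.
elim: t => //= [i _|c _|k _|t1 IH1 t2 IH2 /andP[/IH1 <- /IH2 <-]|t1 IH1 /IH1 <-
               |t1 IH1 k /IH1 <-|t1 IH1 t2 IH2 /andP[/IH1 <- /IH2 <-]|t1 IH1 k /IH1 <-].
- case: insubP => [j _ <-|].
    by rewrite mevalXU nth_mktuple.
  by rewrite -leqNgt => le_ni; rewrite meval0 nth_default // size_map size_enum_ord.
- exact: mevalC.
- by rewrite rmorph_nat.
- exact: mevalD.
- exact: mevalN.
- exact: mevalMn.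
- exact: mevalM.
- exact: rmorphXn.
Qed.

(** On the complement of the product of its nonzero atoms, a quantifier-free
formula has a constant truth value. *)
Lemma qf_eval_generic (f : GRing.formula K) : GRing.qf_form f -> GRing.rformula f ->
  exists2 G : {mpoly K[n]}, G != 0 & exists b, forall y : 'I_n -> K,
    G.@[y] != 0 -> GRing.qf_eval [tuple y i | i < n] f = b.
Proof.
pose generic f := exists2 G : {mpoly K[n]}, G != 0 & exists b, forall y : 'I_n -> K,
  G.@[y] != 0 -> GRing.qf_eval [tuple y i | i < n] f = b.
have both f1 f2 : generic f1 -> generic f2 ->
    exists2 G : {mpoly K[n]}, G != 0 & exists b1 b2, forall y : 'I_n -> K, G.@[y] != 0 ->
      GRing.qf_eval [tuple y i | i < n] f1 = b1 /\
      GRing.qf_eval [tuple y i | i < n] f2 = b2.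
  move=> [G1 nz1 [b1 e1]] [G2 nz2 [b2 e2]].
  exists (G1 * G2); first by rewrite mulf_neq0.
  exists b1, b2 => y; rewrite mevalM mulf_eq0 negb_or => /andP[y1 y2].
  by rewrite e1 ?e2.
elim: f => //=.
- by move=> b _ _; exists 1; [rewrite oner_eq0 | exists b].
- move=> t1 t2 _ /andP[r1 r2].
  pose P := mpoly_of_term t1 - mpoly_of_term t2.
  have PE y : P.@[y] = GRing.eval [tuple y i | i < n] t1
                     - GRing.eval [tuple y i | i < n] t2.
    by rewrite mevalB !meval_mpoly_of_term.
  have [P0|nzP] := eqVneq P 0.
    exists 1; first by rewrite oner_eq0.
    by exists true => y _; rewrite -subr_eq0 -PE P0 meval0 eqxx.
  exists P => //; exists false => y; rewrite PE subr_eq0.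
  exact: negbTE.
- move=> f1 IH1 f2 IH2 /andP[q1 q2] /andP[r1 r2].
  have [G nzG [b1 [b2 e]]] := both _ _ (IH1 q1 r1) (IH2 q2 r2).
  by exists G => //; exists (b1 && b2) => y /e[-> ->].
- move=> f1 IH1 f2 IH2 /andP[q1 q2] /andP[r1 r2].
  have [G nzG [b1 [b2 e]]] := both _ _ (IH1 q1 r1) (IH2 q2 r2).
  by exists G => //; exists (b1 || b2) => y /e[-> ->].
- move=> f1 IH1 f2 IH2 /andP[q1 q2] /andP[r1 r2].
  have [G nzG [b1 [b2 e]]] := both _ _ (IH1 q1 r1) (IH2 q2 r2).
  by exists G => //; exists (b1 ==> b2) => y /e[-> ->].
- move=> f1 IH1 q1 r1; have [G1 nz1 [b1 e1]] := IH1 q1 r1.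
  by exists G1 => //; exists (~~ b1) => y y1; rewrite e1.
Qed.

End GenericTruth.

Section GenericImage.
Variables (K : numClosedFieldType) (N n : nat).

(** The variables of index below [n] are kept free for the target coordinates. *)
Definition term_of_mpoly (p : {mpoly K[N]}) : GRing.term K :=
  \big[GRing.Add/GRing.Const 0]_(m <- msupp p) GRing.Mul (GRing.Const p@_m)
    (\big[GRing.Mul/GRing.Const 1]_(j < N) GRing.Exp (GRing.Var K (n + j)) (m j)).

Lemma rterm_of_mpoly p : GRing.rterm (term_of_mpoly p).
Proof.
apply: (big_ind (fun t => GRing.rterm t)) => //= [t1 t2 -> -> //|m _].
by apply: (big_ind (fun t => GRing.rterm t)) => //= t1 t2 -> ->.
Qed.

Lemma eval_term_of_mpoly p (e : seq K) (x : 'I_N -> K) :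
  (forall j : 'I_N, e`_(n + j) = x j) -> GRing.eval e (term_of_mpoly p) = p.@[x].
Proof.
move=> ex; rewrite mevalE (big_morph (GRing.eval e) (fun _ _ => erefl) erefl).
apply: eq_bigr => m _ /=; congr (_ * _).
rewrite (big_morph (GRing.eval e) (fun _ _ => erefl) erefl).
by apply: eq_bigr => j _ /=; rewrite ex.
Qed.

Lemma holds_bigAnd e (I : finType) (F : I -> GRing.formula K) :
  GRing.holds e (\big[GRing.And/GRing.Bool true]_i F i) <-> forall i, GRing.holds e (F i).
Proof.
suff aux (r : seq I) : GRing.holds e (\big[GRing.And/GRing.Bool true]_(i <- r) F i) <->
    {in r, forall i, GRing.holds e (F i)}.
  rewrite aux; split=> eF i //; exact: eF (mem_index_enum i).
elim: r => [|i r IHr]; first by rewrite big_nil; split.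
rewrite big_cons /= IHr; split=> [[ei er] j|er].
  by rewrite inE => /predU1P[->|/er].
by split=> [|j jr]; apply: er; rewrite inE ?eqxx // jr orbT.
Qed.

(** A form of Chevalley's theorem on constructible images, restricted to the
open set where [D] does not vanish.  The hypothesis is dominance. *)
Lemma generic_image (Phi : 'I_n -> {mpoly K[N]}) (D : {mpoly K[N]}) :
  (forall G : {mpoly K[n]}, G != 0 -> exists x : 'I_N -> K,
     D.@[x] != 0 /\ G.@[fun i => (Phi i).@[x]] != 0) ->
  exists2 G : {mpoly K[n]}, G != 0 & forall y : 'I_n -> K, G.@[y] != 0 ->
    exists x : 'I_N -> K, D.@[x] != 0 /\ forall i, (Phi i).@[x] = y i.
Proof.
move=> dense.
pose body := GRing.And (GRing.Not (GRing.Equal (term_of_mpoly D) (GRing.Const 0)))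
  (\big[GRing.And/GRing.Bool true]_(i < n)
     GRing.Equal (term_of_mpoly (Phi i)) (GRing.Var K i)).
pose f := foldr GRing.Exists body (iota n N).
have rf : GRing.rformula f.
  rewrite /f; elim: (iota n N) => //=; rewrite rterm_of_mpoly /=.
  apply: (big_ind (fun t => GRing.rformula t)) => //= [t1 t2 -> -> //|i _].
  by rewrite rterm_of_mpoly.
have fP (y : 'I_n -> K) : GRing.holds [tuple y i | i < n] f <->
    exists x : 'I_N -> K, D.@[x] != 0 /\ forall i, (Phi i).@[x] = y i.
  rewrite -GRing.foldExistsP; split.
    case=> e ye /= [De /holds_bigAnd Phie]; exists (fun j => e`_(n + j)); split.
      by apply/eqP; move: De; rewrite (eval_term_of_mpoly _ (x := fun j => e`_(n + j))).
    move=> i; have /= := Phie i.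
    rewrite (eval_term_of_mpoly _ (x := fun j => e`_(n + j))) // => ->.
    by rewrite -ye ?nth_mktuple // !inE mem_iota leqNgt ltn_ord.
  case=> x [Dx Phix].
  exists ([tuple y i | i < n] ++ [tuple x j | j < N]).
    move=> k; rewrite !inE mem_iota negb_and -ltnNge -leqNgt nth_cat size_tuple.
    case: ltnP => // le_nk /= le_k.
    by rewrite !nth_default // size_map size_enum_ord // leq_subRL.
  have ex (j : 'I_N) : ([tuple y i | i < n] ++ [tuple x j | j < N])`_(n + j) = x j.
    by rewrite nth_cat size_tuple ltnNge leq_addr addKn nth_mktuple.
  split; first by rewrite /= (eval_term_of_mpoly _ ex); apply/eqP.
  have ey (i : 'I_n) : ([tuple y i | i < n] ++ [tuple x j | j < N])`_i = y i.
    by rewrite nth_cat size_tuple ltn_ord nth_mktuple.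
  by apply/holds_bigAnd => i /=; rewrite (eval_term_of_mpoly _ ex) Phix -ey.
have wf := @ClosedFieldQE.wf_ex_elim K.
have ok := ClosedFieldQE.holds_ex_elim (@solve_monicpoly K).
have /andP[qg rg] := GRing.quantifier_elim_wf wf rf.
have gP e := GRing.quantifier_elim_rformP wf ok e rf.
have [G nzG [b Gb]] := qf_eval_generic n qg rg.
(* if the image generically misses the target, G vanishes on it *)
case: b Gb => Gb; exists G => // y yG.
  by apply/fP/gP; rewrite Gb.
have [x [Dx Gx]] := dense G nzG.
suff : GRing.holds [tuple (Phi i).@[x] | i < n] f by move/gP; rewrite Gb.
by apply/fP; exists x.
Qed.

End GenericImage.

(** * Lines of the projective plane and constructible curves *)

Definition lform (R : comNzRingType) (a : 'rV[R]_3) : {mpoly R[3]} :=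
  \sum_k a 0 k *: 'X_k.

Definition det3 (R : comNzRingType) (a b c : 'rV[R]_3) : R :=
  let x := inord 0 in let y := inord 1 in let z := inord 2 in
    a 0 x * (b 0 y * c 0 z - b 0 z * c 0 y)
  - a 0 y * (b 0 x * c 0 z - b 0 z * c 0 x)
  + a 0 z * (b 0 x * c 0 y - b 0 y * c 0 x).

Lemma sum3E (V : zmodType) (F : 'I_3 -> V) :
  \sum_k F k = F (inord 0) + F (inord 1) + F (inord 2).
Proof.
rewrite !big_ord_recl big_ord0 addr0 addrA.
by congr (F _ + F _ + F _); apply/val_inj; rewrite /= inordK.
Qed.

Lemma ord3P (P : 'I_3 -> Prop) :
  P (inord 0) -> P (inord 1) -> P (inord 2) -> forall k, P k.
Proof.
by move=> P0 P1 P2 [[|[|[|//]]] lt_k];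
  [move: P0 | move: P1 | move: P2]; congr P; apply/val_inj; rewrite /= inordK.
Qed.

Lemma meval_lform (R : comNzRingType) (a v : 'rV[R]_3) :
  (lform a).@[fun k => v 0 k] = \sum_k a 0 k * v 0 k.
Proof.
by rewrite /lform raddf_sum /=; apply: eq_bigr => k _; rewrite mevalZ mevalXU.
Qed.

Section Lines.
Variable K : fieldType.
Implicit Types a b c v : 'rV[K]_3.

Lemma det3_cramer a b c v : det3 a b c != 0 ->
  \sum_k a 0 k * v 0 k = 0 -> \sum_k b 0 k * v 0 k = 0 -> \sum_k c 0 k * v 0 k = 0 ->
  v = 0.
Proof.
rewrite !sum3E /det3 /=.
move: (inord 0) (inord 1) (inord 2) (@ord3P (fun k => v 0 k = 0)) => x y z allP.
set D := (X in X != 0) => nzD av bv cv.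
apply/rowP => k; rewrite mxE; move: k; apply: allP; apply: (mulfI nzD); rewrite mulr0.
- rewrite -[RHS](_ : (b 0 y * c 0 z - b 0 z * c 0 y) * 0
    - (a 0 y * c 0 z - a 0 z * c 0 y) * 0 + (a 0 y * b 0 z - a 0 z * b 0 y) * 0 = _).
    by rewrite -{1}av -{1}bv -{1}cv /D; ring.
  by rewrite !mulr0 subr0 addr0.
- rewrite -[RHS](_ : - (b 0 x * c 0 z - b 0 z * c 0 x) * 0
    + (a 0 x * c 0 z - a 0 z * c 0 x) * 0 - (a 0 x * b 0 z - a 0 z * b 0 x) * 0 = _).
    by rewrite -{1}av -{1}bv -{1}cv /D; ring.
  by rewrite !mulr0 subr0 addr0.
- rewrite -[RHS](_ : (b 0 x * c 0 y - b 0 y * c 0 x) * 0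
    - (a 0 x * c 0 y - a 0 y * c 0 x) * 0 + (a 0 x * b 0 y - a 0 y * b 0 x) * 0 = _).
    by rewrite -{1}av -{1}bv -{1}cv /D; ring.
  by rewrite !mulr0 subr0 addr0.
Qed.

Definition line a : {vspace 'rV[K]_3} := lker (linfun (mulmxr a^T)).

Lemma mem_line a v : (v \in line a) = ((lform a).@[fun k => v 0 k] == 0).
Proof.
rewrite memv_ker lfunE /= meval_lform.
have -> : v *m a^T = (\sum_k a 0 k * v 0 k)%:M.
  apply/matrixP => i j; rewrite !ord1 !mxE mulr1n.
  by apply: eq_bigr => k _; rewrite mxE mulrC.
apply/eqP/eqP => [/matrixP/(_ 0 0)|->]; last by rewrite raddf0.
by rewrite !mxE.
Qed.

Lemma dim_rV3 : \dim {: 'rV[K]_3} = 3%N.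
Proof. by rewrite dimvf /dim /= mul1n. Qed.

Lemma dim_line a : a != 0 -> \dim (line a) = 2%N.
Proof.
move=> nza; apply/eqP; rewrite eqn_leq; apply/andP; split.
  have le3 := dimvS (subvf (line a)); rewrite dim_rV3 in le3.
  rewrite -ltnS ltn_neqAle le3 andbT.
  apply: contra nza => dim3.
  have full : line a = fullv by apply/eqP; rewrite eqEdim subvf /= (eqP dim3) dim_rV3.
  apply/eqP/rowP => k; rewrite mxE.
  have : delta_mx 0 k \in line a by rewrite full memvf.
  rewrite mem_line meval_lform (bigD1 k) //= big1 ?addr0 => [|l ne_lk].
    by rewrite mxE !eqxx mulr1 => /eqP.
  by rewrite mxE eqxx (negbTE ne_lk) mulr0.
pose f : 'Hom('rV[K]_3, 'rV[K]_1) := linfun (mulmxr a^T).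
have := limg_ker_dim f fullv.
rewrite capfv dim_rV3 -/(line a) => dimE.
have : (\dim (f @: fullv) <= 1)%N.
  by rewrite (leq_trans (dimvS (subvf _))) // dimvf /dim.
by rewrite -(leq_add2l (\dim (line a))) dimE addn1 ltnS.
Qed.

Lemma det3_neq0 a b c : det3 a b c != 0 -> [/\ a != 0, b != 0 & c != 0].
Proof.
by move=> nzD; split; apply: contra nzD => /eqP->; apply/eqP; rewrite /det3 /= !mxE; ring.
Qed.

Lemma cap_lines3 a b c : det3 a b c != 0 -> (line a :&: line b :&: line c)%VS = 0%VS.
Proof.
move=> nzD; apply/eqP; rewrite -subv0; apply/subvP => v.
rewrite !memv_cap !mem_line !meval_lform memv0 => /andP[/andP[/eqP av /eqP bv] /eqP cv].
by apply/eqP; apply: det3_cramer nzD av bv cv.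
Qed.

Lemma dim_cap_lines a b c : det3 a b c != 0 -> \dim (line a :&: line b) = 1%N.
Proof.
move=> nzD; have [nza nzb nzc] := det3_neq0 nzD.
have dimS (U V : {vspace 'rV[K]_3}) : (\dim (U + V) <= 3)%N.
  by have := dimvS (subvf (U + V)%VS); rewrite dim_rV3.
apply/eqP; rewrite eqn_leq; apply/andP; split.
  have := dimv_sum_cap (line a :&: line b) (line c).
  rewrite (cap_lines3 nzD) dimv0 addn0 (dim_line nzc) => dimE.
  by have := dimS (line a :&: line b)%VS (line c); rewrite dimE addn2.
have := dimv_sum_cap (line a) (line b); rewrite !dim_line // => dimE.
by have := dimS (line a) (line b); case: (\dim (_ :&: _)) dimE => //; rewrite addn0 => ->.
Qed.

(** The three determinant conditions say that no point lies on two red lines and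
a blue line, on two blue lines and a red line, or on the line [m] and on red and
blue lines of different indices: the intersection points are distinct, and those
with distinct indices are off [m], where the equation forces [F] to vanish. *)
Lemma constructible_of_lines d (a b : 'I_d.+1 -> 'rV[K]_3) (m : 'rV[K]_3)
    (F : dhomog 3 K d) (X : plane_curve K d) :
  (0 < d)%N -> subspace_of X = <[F]>%VS ->
  (forall i, b i = a i + m) ->
  lform m * (F : {mpoly K[3]}) = \prod_i lform (b i) - \prod_i lform (a i) ->
  (forall i i' j, i != i' -> det3 (a i) (a i') (b j) != 0) ->
  (forall i j j', j != j' -> det3 (a i) (b j) (b j') != 0) ->
  (forall i j, i != j -> det3 (a i) (b j) m != 0) ->
  constructible X.
Proof.
move=> d_gt0 XE bE FE aab abb abm.
have other (i : 'I_d.+1) : exists i' : 'I_d.+1, i != i'.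
  exists (if i == ord0 then ord_max else ord0).
  by have [->|//] := eqVneq i ord0; rewrite -val_eqE /= eq_sym -lt0n.
have nza i : a i != 0 by have [i' ne] := other i; have [] := det3_neq0 (aab i i' i ne).
have nzb j : b j != 0 by have [j' ne] := other j; have [] := det3_neq0 (abb j j j' ne).
have nzm : m != 0 by have [j ne] := other ord0; have [] := det3_neq0 (abm ord0 j ne).
have dimab i j : \dim (line (a i) :&: line (b j)) == 1%N.
  by have [j' ne_jj'] := other j; rewrite (dim_cap_lines (abb i _ _ ne_jj')).
have dim2 u : u != 0 -> \dim (line u) == 2%N by move/dim_line->.
exists (fun i => Grassmannian (dim2 _ (nza i))), (fun j => Grassmannian (dim2 _ (nzb j))).
exists (fun i j => Grassmannian (dimab i j)); split=> //=.
- move=> [i j] [i' j'] /= samePt.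
  have {}samePt : (line (a i) :&: line (b j) = line (a i') :&: line (b j'))%VS.
    exact: (congr1 (@subspace_of _ _ _) samePt).
  have no0 (U : {vspace 'rV[K]_3}) : (line (a i) :&: line (b j) <= U)%VS -> U <> 0%VS.
    by move=> sU U0; have := dimab i j; move: sU; rewrite U0 subv0 => /eqP->; rewrite dimv0.
  congr (_, _); apply/eqP/negPn/negP.
    move=> /(aab i i' j)/cap_lines3; apply: no0.
    by rewrite !subv_cap capvSl capvSr {1}samePt capvSl.
  move=> /(abb i j j')/cap_lines3; apply: no0.
  by rewrite !subv_cap capvSl capvSr {1}samePt capvSr.
(* at a diagonal point both a i and a i + m vanish, hence so does m *)
- exists (Grassmannian (dim2 _ nzm)) => i /=; apply/subvP => v.
  rewrite memv_cap !mem_line bE !meval_lform => /andP[/eqP av].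
  suff -> : \sum_k (a i + m) 0 k * v 0 k = \sum_k m 0 k * v 0 k by [].
  transitivity (\sum_k a i 0 k * v 0 k + \sum_k m 0 k * v 0 k).
    rewrite -big_split /=.
    by apply: eq_bigr => k _; rewrite mxE mulrDl.
  by rewrite av add0r.
move=> i j ne_ij f v; rewrite XE => /vlineP[c ->] /=.
rewrite memv_cap !mem_line => /andP[av bv].
rewrite mevalZ; suff -> : (F : {mpoly K[3]}).@[fun k => v 0 k] = 0 by rewrite mulr0.
have /eqP := congr1 (meval (fun k => v 0 k)) FE.
rewrite mevalM mevalB !rmorph_prod /= (bigD1 j) //= (eqP bv) mul0r.
rewrite (bigD1 i) //= (eqP av) mul0r subr0 mulf_eq0 => /orP[mv|/eqP//].
(* here m vanishes at v, so v is the zero vector and F, of positive degree, too *)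
have -> : v = 0.
  by move: av bv mv; rewrite !meval_lform => /eqP av /eqP bv /eqP mv;
     apply: det3_cramer (abm i j ne_ij) av bv mv.
have := meval_dhomog 0 (fun=> 0) (dhomog_is_dhomog F).
rewrite expr0n (gtn_eqF d_gt0) [RHS]mul0r => zE; rewrite -[RHS]zE.
by apply: meval_eq => k; rewrite mxE mul0r.
Qed.

End Lines.

(** * Configurations of red and blue lines *)

(** The quotient of prod (a + m) - prod a by [m], given by a recursion so that it
makes sense over any commutative ring and commutes with ring morphisms. *)
Fixpoint diff_quotient (S : comNzRingType) (m : S) (s : seq S) : S :=
  if s is a :: s' then a * diff_quotient m s' + \prod_(b <- s') (b + m) else 0.

Lemma mul_diff_quotient (S : comNzRingType) (m : S) s :
  m * diff_quotient m s = \prod_(a <- s) (a + m) - \prod_(a <- s) a.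
Proof.
elim: s => [|a s IHs] /=; first by rewrite !big_nil mulr0 subrr.
by rewrite !big_cons mulrDr mulrCA IHs; ring.
Qed.

Lemma rmorph_diff_quotient (S S' : comNzRingType) (f : {rmorphism S -> S'}) m s :
  f (diff_quotient m s) = diff_quotient (f m) [seq f a | a <- s].
Proof.
elim: s => [|a s IHs] /=; first exact: rmorph0.
rewrite rmorphD rmorphM IHs rmorph_prod big_map; congr (_ + _).
by apply: eq_bigr => b _; rewrite rmorphD.
Qed.

Lemma lform_homog (R : comNzRingType) (a : 'rV[R]_3) : lform a \is 1.-homog.
Proof. by apply: rpred_sum => k _; apply: rpredZ; rewrite dhomogX /= mdeg1. Qed.

Lemma diff_quotient_homog n (R : comNzRingType) (m : {mpoly R[n]}) a s :
  m \is 1.-homog -> {in a :: s, forall b, b \is 1.-homog} ->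
  diff_quotient m (a :: s) \is (size s).-homog.
Proof.
move=> hm; elim: s a => [|b s IHs] a hs.
  by rewrite /= mulr0 add0r big_nil dhomog1.
have ha : a \is 1.-homog by apply: hs; rewrite mem_head.
have {}hs : {in b :: s, forall c, c \is 1.-homog}.
  by move=> c cs; apply: hs; rewrite inE cs orbT.
rewrite [diff_quotient _ _]/=; apply: rpredD.
  by rewrite -[size _]/(1 + size s)%N; apply: dhomogM => //; apply: IHs.
elim: (b :: s) hs => [|c t IHt] ht; first by rewrite big_nil dhomog1.
rewrite big_cons -[size _]/(1 + size t)%N; apply: dhomogM.
  by apply: rpredD => //; apply: ht; rewrite mem_head.
by apply: IHt => e et; apply: ht; rewrite inE et orbT.
Qed.

Section Configurations.
Variable d : nat.

(** A configuration is a matrix of coefficients of linear forms: row 0 is the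
form [m] of the diagonal, the other rows are the red lines. *)
Definition shift (R : comNzRingType) (M : 'M[R]_(d.+2, 3)) := row ord0 M.
Definition red (R : comNzRingType) (M : 'M[R]_(d.+2, 3)) (i : 'I_d.+1) :=
  row (lift ord0 i) M.
Definition blue (R : comNzRingType) (M : 'M[R]_(d.+2, 3)) (j : 'I_d.+1) :=
  red M j + shift M.

Definition config_form (R : comNzRingType) (M : 'M[R]_(d.+2, 3)) : {mpoly R[3]} :=
  diff_quotient (lform (shift M)) [seq lform (red M i) | i <- enum 'I_d.+1].

Definition config_disc (R : comNzRingType) (M : 'M[R]_(d.+2, 3)) : R :=
  \prod_i \prod_(j | i != j) (det3 (red M i) (blue M j) (shift M) *
    \prod_k (det3 (red M i) (red M j) (blue M k) * det3 (red M k) (blue M i) (blue M j))).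

Lemma lformD (R : comNzRingType) (a b : 'rV[R]_3) : lform (a + b) = lform a + lform b.
Proof. by rewrite -big_split; apply: eq_bigr => k _; rewrite mxE scalerDl. Qed.

Lemma config_formE (R : comNzRingType) (M : 'M[R]_(d.+2, 3)) :
  lform (shift M) * config_form M = \prod_i lform (blue M i) - \prod_i lform (red M i).
Proof.
rewrite mul_diff_quotient; do 2!rewrite big_map big_enum; congr (_ - _).
by apply: eq_bigr => i _; rewrite lformD.
Qed.

Lemma config_form_homog (R : comNzRingType) (M : 'M[R]_(d.+2, 3)) :
  config_form M \is d.-homog.
Proof.
have sE : size (enum 'I_d.+1) = d.+1 by rewrite size_enum_ord.
rewrite /config_form; case: (enum _) sE => [//|i s] [sE].
have : diff_quotient (lform (shift M)) [seq lform (red M k) | k <- i :: s]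
    \is (size [seq lform (red M k) | k <- s]).-homog.
  apply: diff_quotient_homog; first exact: lform_homog.
  by move=> b /(mapP (s := i :: s))[k _ ->]; apply: lform_homog.
by rewrite size_map sE.
Qed.

Lemma map_lform (R R' : comNzRingType) (f : {rmorphism R -> R'}) (a : 'rV[R]_3) :
  map_mpoly f (lform a) = lform (map_mx f a).
Proof.
by rewrite rmorph_sum; apply: eq_bigr => k _; rewrite /= map_mpolyZ map_mpolyX mxE.
Qed.

Lemma map_config_form (R R' : comNzRingType) (f : {rmorphism R -> R'})
    (M : 'M[R]_(d.+2, 3)) :
  map_mpoly f (config_form M) = config_form (map_mx f M).
Proof.
rewrite rmorph_diff_quotient /= map_lform map_row; congr diff_quotient.
by rewrite -map_comp; apply: eq_map => i /=; rewrite map_lform map_row.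
Qed.

Lemma map_det3 (R R' : comNzRingType) (f : {rmorphism R -> R'}) (a b c : 'rV[R]_3) :
  f (det3 a b c) = det3 (map_mx f a) (map_mx f b) (map_mx f c).
Proof. by rewrite /det3 /= !mxE !(rmorphD, rmorphN, rmorphM, rmorphB). Qed.

Lemma map_config_disc (R R' : comNzRingType) (f : {rmorphism R -> R'})
    (M : 'M[R]_(d.+2, 3)) :
  f (config_disc M) = config_disc (map_mx f M).
Proof.
rewrite rmorph_prod; apply: eq_bigr => i _; rewrite rmorph_prod.
apply: eq_bigr => j _; rewrite rmorphM map_det3 rmorph_prod.
rewrite /blue /red /shift !map_mxD !map_row; congr (_ * _).
by apply: eq_bigr => k _; rewrite rmorphM !map_det3 !map_mxD !map_row.
Qed.

Lemma constructible_of_config (K : fieldType) (M : 'M[K]_(d.+2, 3)) (F : dhomog 3 K d)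
    (X : plane_curve K d) :
  (0 < d)%N -> subspace_of X = <[F]>%VS -> config_disc M != 0 ->
  mpoly_of_dhomog F = config_form M -> constructible X.
Proof.
move=> d_gt0 XE nzM FE.
have nz i j : i != j -> det3 (red M i) (blue M j) (shift M) != 0 /\
    forall k, det3 (red M i) (red M j) (blue M k) != 0 /\
              det3 (red M k) (blue M i) (blue M j) != 0.
  move=> ne_ij; move/prodf_neq0: nzM => /(_ i isT)/prodf_neq0/(_ j ne_ij).
  rewrite mulf_eq0 negb_or => /andP[-> /prodf_neq0 nzk]; split=> // k.
  by apply/andP; rewrite -negb_or -mulf_eq0; apply: nzk.
apply: (constructible_of_lines (a := red M) (b := blue M) (m := shift M) d_gt0 XE) => //.
- by rewrite FE config_formE.
- by move=> i i' j /nz[_ /(_ j)[]].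
- by move=> i j j' /nz[_ /(_ i)[]].
- by move=> i j /nz[].
Qed.

(** Take the red lines dual to points (1, x, x ^ 2) of a conic with x even.  All
the determinants are, up to a factor x i - x j, odd integers: the Vandermonde
part is a multiple of 4, and shifting by (0, 0, 1) adds 1 or -1. *)
Lemma config_disc_neq0 (K : numFieldType) : exists M : 'M[K]_(d.+2, 3), config_disc M != 0.
Proof.
pose x (k : nat) : int := 2 * k%:Z.
pose M : 'M[int]_(d.+2, 3) := \matrix_(i, k)
  if i == 0 then (k == 2 :> nat)%:R else x i.-1 ^+ k.
have redE i k : red M i 0 k = x i ^+ k by rewrite !mxE.
have shiftE k : shift M 0 k = (k == 2 :> nat)%:R by rewrite !mxE.
have blueE i k : blue M i 0 k = x i ^+ k + (k == 2 :> nat)%:R.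
  by rewrite mxE redE shiftE.
suff nzM : config_disc M != 0.
  exists (map_mx intr M).
  by rewrite -(map_config_disc (intr : {rmorphism int -> K})) intr_eq0.
apply/prodf_neq0 => i _; apply/prodf_neq0 => j ne_ij.
have nzx : x i - x j != 0.
  by rewrite -mulrBr mulf_eq0 negb_or /= subr_eq0 eqz_nat.
have d1 : det3 (red M i) (blue M j) (shift M) = - (x i - x j).
  by rewrite /det3 /= !redE !blueE !shiftE !inordK //=; ring.
have d2 k : det3 (red M i) (red M j) (blue M k)
    = - (x i - x j) * (4 * ((k%:Z - i%:Z) * (k%:Z - j%:Z)) + 1).
  by rewrite /det3 /= !redE !blueE !inordK //= /x; ring.
have d3 k : det3 (red M k) (blue M i) (blue M j)
    = - (x i - x j) * (4 * ((i%:Z - k%:Z) * (j%:Z - k%:Z)) - 1).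
  by rewrite /det3 /= !redE !blueE !inordK //= /x; ring.
have nz4 t : 4 * t + 1 != 0 :> int by lia.
have nz4' t : 4 * t - 1 != 0 :> int by lia.
rewrite d1 mulf_neq0 ?oppr_eq0 //; apply/prodf_neq0 => k _.
by rewrite d2 d3 !mulf_neq0 ?oppr_eq0.
Qed.

End Configurations.

(** * Coordinates on the space of forms *)

Section Coordinates.
Variables (K : fieldType) (d : nat).

Notation dimF := (\dim {:dhomog 3 K d}).

Definition homog_part (p : {mpoly K[3]}) : dhomog 3 K d :=
  DHomog (pihomogP mdeg d p).

(** Projecting to degree [d] first makes this a linear function on all polynomials,
so that it can be applied coefficientwise. *)
Definition form_coord (i : 'I_dimF) (p : {mpoly K[3]}) : K :=
  coord (vbasis {:dhomog 3 K d}) i (homog_part p).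

Lemma form_coord_is_linear i : linear_for *%R (form_coord i).
Proof.
move=> c p q; rewrite /form_coord.
have -> : homog_part (c *: p + q) = c *: homog_part p + homog_part q.
  by apply/val_inj; rewrite /= linearP.
by rewrite linearP.
Qed.
HB.instance Definition _ i :=
  GRing.isLinear.Build K {mpoly K[3]} K _ (form_coord i) (form_coord_is_linear i).

Lemma form_coordE (F : dhomog 3 K d) i :
  form_coord i (mpoly_of_dhomog F) = coord (vbasis {:dhomog 3 K d}) i F.
Proof.
congr (coord _ _ _); apply/val_inj => /=.
by rewrite pihomog_dE // dhomog_is_dhomog.
Qed.

Lemma form_coord_onto (w : 'I_dimF -> K) :
  exists F : dhomog 3 K d, forall i, form_coord i (mpoly_of_dhomog F) = w i.
Proof.
exists (\sum_i w i *: (vbasis {:dhomog 3 K d})`_i) => i.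
by rewrite form_coordE coord_sum_free // (basis_free (vbasisP _)).
Qed.

Lemma form_coord_inj (F : dhomog 3 K d) (p : {mpoly K[3]}) :
  p \is d.-homog -> (forall i, form_coord i p = form_coord i (mpoly_of_dhomog F)) ->
  mpoly_of_dhomog F = p.
Proof.
move=> hp eqc; rewrite -[p]/(mpoly_of_dhomog (DHomog hp)); congr mpoly_of_dhomog.
rewrite (coord_vbasis (memvf F)) (coord_vbasis (memvf (DHomog hp))).
by apply: eq_bigr => i _; rewrite -!form_coordE -eqc.
Qed.

Definition matrix_of_params (R : comNzRingType) (x : 'I_(d.+2 * 3) -> R) : 'M[R]_(d.+2, 3) :=
  \matrix_(k, l) x (mxvec_index k l).

Lemma matrix_of_paramsK (R : comNzRingType) (M : 'M[R]_(d.+2, 3)) :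
  matrix_of_params (fun k => mxvec M 0 k) = M.
Proof. by apply/matrixP => k l; rewrite mxE mxvecE. Qed.

Lemma map_matrix_of_params (R R' : comNzRingType) (f : R -> R') x :
  map_mx f (matrix_of_params x) = matrix_of_params (fun k => f (x k)).
Proof. by apply/matrixP => k l; rewrite !mxE. Qed.

Definition generic_config := matrix_of_params (fun k => 'X_k : {mpoly K[d.+2 * 3]}).

Lemma meval_generic_config x :
  map_mx (meval x) generic_config = matrix_of_params x.
Proof. by rewrite map_matrix_of_params; apply/matrixP => k l; rewrite !mxE mevalXU. Qed.

Lemma meval_config_disc x :
  (config_disc generic_config).@[x] = config_disc (matrix_of_params x).
Proof. by rewrite -meval_generic_config map_config_disc. Qed.

Definition coord_map i : {mpoly K[d.+2 * 3]} :=
  \sum_(m <- msupp (config_form generic_config))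
    form_coord i 'X_[m] *: (config_form generic_config)@_m.

Lemma meval_coord_map x i :
  (coord_map i).@[x] = form_coord i (config_form (matrix_of_params x)).
Proof.
rewrite -meval_generic_config -map_config_form /coord_map /map_mpoly /mmap.
rewrite raddf_sum linear_sum; apply: eq_bigr => m _ /=.
by rewrite mevalZ mmap1_id mul_mpolyC linearZ /= mulrC.
Qed.

(** The forms of the configurations [M] + t [D], as one polynomial in t over the
ring of ternary polynomials: there its coefficient of degree 1, which is the
differential of [config_form] at [M] in the direction [D], follows from the
product rule alone. *)
Definition config_pencil (M D : 'M[K]_(d.+2, 3)) : {poly {mpoly K[3]}} :=
  diff_quotient ((lform (shift M))%:P + (lform (shift D))%:P * 'X)
    [seq (lform (red M i))%:P + (lform (red D i))%:P * 'X | i <- enum 'I_d.+1].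

Lemma lformZ (R : comNzRingType) c (a : 'rV[R]_3) : lform (c *: a) = c *: lform a.
Proof. by rewrite scaler_sumr; apply: eq_bigr => k _; rewrite mxE scalerA. Qed.

Lemma horner_config_pencil (M D : 'M[K]_(d.+2, 3)) t :
  (config_pencil M D).[t%:MP] = config_form (M + t *: D).
Proof.
have lineE (a b : 'rV[K]_3) :
    ((lform a)%:P + (lform b)%:P * 'X).[t%:MP] = lform (a + t *: b).
  by rewrite lformD lformZ !hornerE /= -mul_mpolyC mulrC.
rewrite -/(horner_eval _ _) rmorph_diff_quotient /= /horner_eval lineE.
rewrite /shift /config_form /shift linearD linearZ; congr diff_quotient.
rewrite -map_comp; apply: eq_map => i /=.
by rewrite /red lineE linearD linearZ.
Qed.

End Coordinates.

(** * Dominance *)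

Section Density.
Variables (K : numFieldType) (d : nat).

Lemma horner_form_coord i (q : {poly {mpoly K[3]}}) t :
  (map_poly (form_coord (d := d) i) q).[t] = form_coord i q.[t%:MP].
Proof.
rewrite (horner_coef_wide _ (size_poly _ _)) horner_coef linear_sum.
apply: eq_bigr => k _; rewrite coef_map /=.
by rewrite -rmorphXn /= [q`_k * _]mulrC mul_mpolyC linearZ /= mulrC.
Qed.

(** The curves needed to exclude a hypersurface are the images of the lines
through [M0]; general position is an open condition that holds somewhere. *)
Lemma config_forms_dense (M0 : 'M[K]_(d.+2, 3)) :
  (forall g : {mpoly K[3]}, g \is d.-homog -> exists D, (config_pencil M0 D)`_1 = g) ->
  forall G : {mpoly K[\dim {:dhomog 3 K d}]}, G != 0 ->
  exists x : 'I_(d.+2 * 3) -> K, (config_disc (generic_config K d)).@[x] != 0 /\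
    G.@[fun i => (coord_map i).@[x]] != 0.
Proof.
move=> onto G nzG.
pose P := G \mPo [tuple coord_map i | i < \dim {:dhomog 3 K d}].
have PE x : P.@[x] = G.@[fun i => form_coord i (config_form (matrix_of_params x))].
  rewrite comp_mpoly_meval; apply: meval_eq => i.
  by rewrite tnth_mktuple meval_coord_map.
have nzdisc : config_disc (generic_config K d) != 0.
  have [M nzM] := config_disc_neq0 d K; apply: contra nzM => /eqP disc0.
  by rewrite -(matrix_of_paramsK M) -meval_config_disc disc0 meval0.
have nzP : P != 0.
  apply: contra nzG => /eqP P0; apply/eqP.
  apply: (eq0_of_curves (y0 := fun i => form_coord i (config_form M0))) => w.
  have [F Fw] := form_coord_onto w.
  have [D DF] := onto F (dhomog_is_dhomog F).
  exists (fun i => map_poly (form_coord i) (config_pencil M0 D)); split=> [i|i|t].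
  - by rewrite coef_map -horner_coef0 -[0]/(0%:MP) horner_config_pencil scale0r addr0.
  - by rewrite coef_map /= DF Fw.
  rewrite -[RHS](meval0 (fun k => mxvec (M0 + t *: D) 0 k)) -P0 PE.
  by apply: meval_eq => i; rewrite horner_form_coord horner_config_pencil matrix_of_paramsK.
have [x] := meval_neq0 (mulf_neq0 nzdisc nzP).
rewrite mevalM mulf_eq0 negb_or => /andP[nzx nzPx]; exists x; split=> //.
by move: nzPx; rewrite comp_mpoly_meval (meval_eq _ (v2 := fun i => (coord_map i).@[x])) // => i;
  rewrite tnth_mktuple.
Qed.

End Density.

(** * From an affine to a projective open set *)

Lemma pihomog_neq0 (K : comNzRingType) n (G : {mpoly K[n]}) :
  G != 0 -> exists k, pihomog mdeg k G != 0.
Proof.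
move=> nzG; apply: contrapT => /forallNP G0; case/eqP: nzG.
rewrite (pihomog_partitionE (leqnn (msize G))); apply: big1 => k _.
by apply/eqP/negPn/negP; apply: G0.
Qed.

Lemma scale_meval_neq0 (K : numFieldType) n (G : {mpoly K[n]}) k (y : 'I_n -> K) :
  (pihomog mdeg k G).@[y] != 0 -> exists2 c, c != 0 & G.@[fun i => c * y i] != 0.
Proof.
move=> nzGk; apply: contrapT => noc.
pose P := \poly_(e < maxn k.+1 (msize G)) (pihomog mdeg e G).@[y].
have PE c : P.[c] = G.@[fun i => c * y i].
  rewrite (meval_scaleE c y (leq_maxr k.+1 (msize G))) horner_poly.
  by apply: eq_bigr => e _; rewrite mulrC.
have XP0 : 'X * P = 0.
  apply: poly_eq0_horner => c; rewrite hornerM hornerX PE.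
  have [->|nzc] := eqVneq c 0; first by rewrite mul0r.
  have [->|nzGc] := eqVneq (G.@[fun i => c * y i]) 0; first by rewrite mulr0.
  by case: noc; exists c.
case/eqP: nzGk; have := congr1 (fun Q : {poly K} => Q`_k.+1) XP0.
by rewrite coef0 coefXM /= coef_poly leq_maxl.
Qed.

(** Only finitely many multiples of a form can lie on the hypersurface [G] = 0 when
some homogeneous component of [G] does not vanish on it, and its nonzero
multiples define the same curve.  A coordinate is multiplied into [G] so that the zero
form lies on the hypersurface. *)
Theorem constructible_dense (K : numClosedFieldType) d (M0 : 'M[K]_(d.+2, 3)) :
  (0 < d)%N ->
  (forall g : {mpoly K[3]}, g \is d.-homog -> exists D, (config_pencil M0 D)`_1 = g) ->
  exists U : set (plane_curve K d),
    [/\ zariski_open U, U !=set0 & forall X, U X -> constructible X].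
Proof.
move=> d_gt0 /config_forms_dense/generic_image[G nzG Gconfig].
set V := dhomog 3 K d in G nzG Gconfig *.
have V_gt0 : (0 < \dim {:V})%N.
  rewrite lt0n dimv_eq0 -subv0; apply/negP => /subvP/(_ _ (memvf _)).
  pose X0 : V := DHomog (pihomogP mdeg d ('X_[U_(ord0) *+ d])).
  move=> /(_ X0); rewrite memv0 => /eqP/(congr1 (mcoeff (U_(ord0) *+ d) \o val)).
  rewrite /= pihomogX /= mdegMn mdeg1 mul1n eqxx mcoeffX eqxx mcoeff0.
  by move/eqP; rewrite oner_eq0.
have [k nzGk] : exists k, pihomog mdeg k ('X_(Ordinal V_gt0) * G) != 0.
  apply: pihomog_neq0; rewrite mulf_neq0 //; apply/eqP => X0.
  have := congr1 (meval (fun=> 1)) X0; rewrite mevalXU meval0 => /eqP.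
  by rewrite oner_eq0.
set H := _ * G in nzGk; set Hk := pihomog mdeg k H in nzGk.
pose coords (F : V) i := coord (vbasis {:V}) i F.
have scaled F : Hk.@[coords F] != 0 ->
    [/\ F != 0 & exists2 c, c != 0 & G.@[fun i => c * coords F i] != 0].
  case/scale_meval_neq0 => c nzc; rewrite mevalM mevalXU mulf_eq0 negb_or.
  case/andP=> nzF nzGF; split; last by exists c.
  by apply: contra nzF => /eqP->; rewrite /coords linear0 mulr0.
exists [set X | ~ vanishes_at Hk X]; split.
- exists [set Hk]; split=> [_ ->|]; first by exists k; apply: pihomogP.
  rewrite predeqE => X; split=> [/contrapT HX _ -> //|HX] /=.
  by apply; apply: HX.
- have [y nzy] := meval_neq0 nzGk.
  have [F Fy] := form_coord_onto y.
  have nzHF : Hk.@[coords F] != 0.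
    by rewrite (meval_eq (v2 := y)) // => i; rewrite /coords -form_coordE.
  have [nzF _] := scaled F nzHF.
  have dimF : \dim <[F]>%VS == 1%N by rewrite dim_vline nzF.
  exists (Grassmannian dimF) => /= /(_ F (memv_line F)) HF0.
  by move: nzHF; rewrite HF0 eqxx.
move=> X /= /existsNP[F /not_implyP[XF /eqP/scaled[nzF [c nzc /Gconfig[x [nzdisc Ex]]]]]].
have XE : subspace_of X = <[c *: F]>%VS.
  apply/eqP; rewrite eq_sym eqEdim -memvE memvZ //= dim_vline scaler_eq0.
  by rewrite negb_or nzc nzF; case: X {XF} => W /= /eqP->.
apply: (constructible_of_config (M := matrix_of_params x) d_gt0 XE).
  by rewrite -meval_config_disc.
apply: form_coord_inj; first exact: config_form_homog.
by move=> i; rewrite -meval_coord_map Ex form_coordE linearZ.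
Qed.

(** * The tangent space at the special configuration *)

(** The special configuration has m = 2z and the red lines x - z and x - 2z, for
x among u, v and w = - u - v.  With [p] and [q] the elementary symmetric
functions of degree 2 and 3 of u, v, w, the next three quartics are the partial
derivatives of the quintic with respect to the red lines x - z (near) and x - 2z
(far) and to m. *)
Definition partial_near (S : comNzRingType) (p q z x : S) : S :=
  p ^+ 2 - x ^+ 4 + p * x * z + z ^+ 2 * (5 * p + 4 * x ^+ 2) + 4 * z ^+ 3 * x + 4 * z ^+ 4.
Definition partial_far (S : comNzRingType) (p q z x : S) : S :=
  (z ^+ 2 + p) * (2 * z ^+ 2 + x * z + x ^+ 2 + p) - q * (2 * z + x).
Definition partial_shift (S : comNzRingType) (p q z : S) : S :=
  p ^+ 2 + 3 * p * z ^+ 2 + 2 * z ^+ 4 - q * z.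

Section TangentSpan.
(* [T] stands for the tangent space and [L] for the linear forms *)
Variables (S : comNzRingType) (T L : S -> Prop) (u v z : S).
Hypotheses (TD : forall f g, T f -> T g -> T (f + g)) (TN : forall f, T f -> T (- f)).
Hypothesis Tdiv : forall n f, T (f *+ n.+1) -> T f.
Hypotheses (Lu : L u) (Lv : L v) (Lz : L z) (Lw : L (- u - v)).

Let p := u * v + u * (- u - v) + v * (- u - v).
Let q := u * v * (- u - v).

(* the quartics all of whose multiples by linear forms are tangent *)
Let inW g := forall l, L l -> T (l * g).

Hypothesis W1 : forall x, x \in [:: u; v; - u - v] -> inW (partial_near p q z x).
Hypothesis W2 : forall x, x \in [:: u; v; - u - v] -> inW (partial_far p q z x).
Hypothesis Wm : inW (partial_shift p q z).

Let TMn n f : T f -> T (f *+ n.+1).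
Proof. by move=> Tf; elim: n => [|n IHn]; rewrite ?mulr1n // mulrS; apply: TD. Qed.

Ltac inT := repeat match goal with
  | |- T _ => assumption
  | |- T (_ + _) => apply: TD
  | |- T (- _) => apply: TN
  | |- T (_ *+ _) => apply: TMn
  end.

Let WD f g : inW f -> inW g -> inW (f + g).
Proof. by move=> Wf Wg l Ll; rewrite mulrDr; apply: TD; [apply: Wf | apply: Wg]. Qed.
Let WN f : inW f -> inW (- f).
Proof. by move=> Wf l Ll; rewrite mulrN; apply/TN/Wf. Qed.
Let WMn n f : inW f -> inW (f *+ n.+1).
Proof. by move=> Wf l Ll; rewrite mulrnAr; apply/TMn/Wf. Qed.
Let Wdiv n f : inW (f *+ n.+1) -> inW f.
Proof. by move=> Wf l Ll; apply: (@Tdiv n); rewrite -mulrnAr; apply: Wf. Qed.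

Ltac inWt := repeat match goal with
  | |- inW _ => assumption
  | |- inW (_ + _) => apply: WD
  | |- inW (- _) => apply: WN
  | |- inW (_ *+ _) => apply: WMn
  end.

Let qE x : x \in [:: u; v; - u - v] -> q = x ^+ 3 + p * x.
Proof. by rewrite !inE => /or3P[] /eqP->; rewrite /p /q; ring. Qed.

Let Lx x : x \in [:: u; v; - u - v] -> L x.
Proof. by rewrite !inE => /or3P[] /eqP->. Qed.

(* Symmetric combinations of the quartics first, then for each x one divisible by
   z ^ 2, and one whose part free of z is a multiple of p ^ 2 - x ^ 4. *)
Let Wc : inW (z ^+ 4 + q * z).
Proof.
apply: (@Wdiv 5).
have -> : (z ^+ 4 + q * z) *+ 6 =
    (partial_near p q z u - partial_far p q z u) + (partial_near p q z v - partial_far p q z v)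
    + (partial_near p q z (- u - v) - partial_far p q z (- u - v)).
  by rewrite /partial_near /partial_far /p /q; ring.
by inWt; [apply: W1 | apply: W2 | apply: W1 | apply: W2 | apply: W1 | apply: W2];
   rewrite !inE eqxx ?orbT.
Qed.

Let Wb : inW (9 * z ^+ 4 + 4 * p * z ^+ 2).
Proof.
apply: (@Wdiv 1).
have -> : (9 * z ^+ 4 + 4 * p * z ^+ 2) *+ 2 =
    (z ^+ 4 + q * z) *+ 4
    + (partial_near p q z u + partial_near p q z v + partial_near p q z (- u - v)
       + partial_far p q z u + partial_far p q z v + partial_far p q z (- u - v))
    - partial_shift p q z *+ 2.
  by rewrite /partial_near /partial_far /partial_shift /p /q; ring.
by inWt; (apply: W1 || apply: W2); rewrite !inE eqxx ?orbT.
Qed.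

Let Wg x : x \in [:: u; v; - u - v] -> inW (z ^+ 2 * (3 * z * x + 3 * x ^+ 2 + 2 * p)).
Proof.
move=> xin.
have -> : z ^+ 2 * (3 * z * x + 3 * x ^+ 2 + 2 * p) =
    partial_near p q z x - partial_far p q z x - (z ^+ 4 + q * z) *+ 2.
  by rewrite /partial_near /partial_far (qE xin); ring.
by inWt; [apply: W1 | apply: W2].
Qed.

Let Wh x : x \in [:: u; v; - u - v] ->
  inW (4 * (p ^+ 2 - x ^+ 4) + 4 * p * x * z + 5 * q * z).
Proof.
move=> xin; apply: (@Wdiv 2).
have -> : (4 * (p ^+ 2 - x ^+ 4) + 4 * p * x * z + 5 * q * z) *+ 3 =
    partial_near p q z x *+ 12 - (z ^+ 2 * (3 * z * x + 3 * x ^+ 2 + 2 * p)) *+ 16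
    - (9 * z ^+ 4 + 4 * p * z ^+ 2) *+ 7 + (z ^+ 4 + q * z) *+ 15.
  by rewrite /partial_near /partial_far; ring.
by inWt; [apply: W1 | apply: Wg].
Qed.

Let uin : u \in [:: u; v; - u - v]. Proof. by rewrite !inE eqxx. Qed.
Let vin : v \in [:: u; v; - u - v]. Proof. by rewrite !inE eqxx orbT. Qed.
Let win : - u - v \in [:: u; v; - u - v]. Proof. by rewrite !inE eqxx !orbT. Qed.

(* Descending induction on the power of z.  The quintics divisible by z ^ 4 come
   from the relation q = x ^ 3 + p * x, which turns z ^ 2 * x ^ 3 into a
   combination of z ^ 4 * x and z ^ 5; summing over x removes the former. *)
Let z4_aux x : x \in [:: u; v; - u - v] -> T (6 * z ^+ 5 - 3 * z ^+ 4 * x).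
Proof.
move=> xin.
have -> : 6 * z ^+ 5 - 3 * z ^+ 4 * x =
    (x * (z ^+ 2 * (3 * z * x + 3 * x ^+ 2 + 2 * p))) *+ 4
    - (z * (z ^+ 2 * (3 * z * x + 3 * x ^+ 2 + 2 * p))) *+ 4
    + x * (9 * z ^+ 4 + 4 * p * z ^+ 2) + (z * (9 * z ^+ 4 + 4 * p * z ^+ 2)) *+ 2
    - (z * (z ^+ 4 + q * z)) *+ 12.
  by rewrite (qE xin); ring.
by inT; [apply/Wg/Lx | apply: Wg | apply/Wb/Lx | apply: Wb | apply: Wc].
Qed.

Let z5 : T (z ^+ 5).
Proof.
apply: (@Tdiv 17).
have -> : z ^+ 5 *+ 18 = (6 * z ^+ 5 - 3 * z ^+ 4 * u) + (6 * z ^+ 5 - 3 * z ^+ 4 * v)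
    + (6 * z ^+ 5 - 3 * z ^+ 4 * (- u - v)) by ring.
by have := z4_aux uin; have := z4_aux vin; have := z4_aux win; move=> *; inT.
Qed.

Let z4 x : x \in [:: u; v; - u - v] -> T (z ^+ 4 * x).
Proof.
move=> xin; apply: (@Tdiv 2).
have -> : z ^+ 4 * x *+ 3 = z ^+ 5 *+ 6 - (6 * z ^+ 5 - 3 * z ^+ 4 * x) by ring.
by have := z4_aux xin; move=> ?; inT.
Qed.

(* multiples of z ^ 3: the squares of u, v, w span the quadratic forms in u and v *)
Let z3p : T (p * z ^+ 3).
Proof.
apply: (@Tdiv 3).
have -> : p * z ^+ 3 *+ 4 = z * (9 * z ^+ 4 + 4 * p * z ^+ 2) - z ^+ 5 *+ 9 by ring.
by inT; apply: Wb.
Qed.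

Let z3 x : x \in [:: u; v; - u - v] -> T (z ^+ 3 * x ^+ 2).
Proof.
move=> xin; apply: (@Tdiv 2).
have -> : z ^+ 3 * x ^+ 2 *+ 3 = z * (z ^+ 2 * (3 * z * x + 3 * x ^+ 2 + 2 * p))
    - z ^+ 4 * x *+ 3 - p * z ^+ 3 *+ 2 by ring.
by inT; [apply: Wg | apply: z4].
Qed.

Let z3uv : T (z ^+ 3 * (u * v)).
Proof.
apply: (@Tdiv 1).
have -> : z ^+ 3 * (u * v) *+ 2 =
  z ^+ 3 * (- u - v) ^+ 2 - z ^+ 3 * u ^+ 2 - z ^+ 3 * v ^+ 2 by ring.
by inT; apply: z3.
Qed.

(* multiples of z ^ 2 *)
Let z2p x : x \in [:: u; v; - u - v] -> T (p * z ^+ 2 * x).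
Proof.
move=> xin; apply: (@Tdiv 3).
have -> : p * z ^+ 2 * x *+ 4 = x * (9 * z ^+ 4 + 4 * p * z ^+ 2) - z ^+ 4 * x *+ 9 by ring.
by inT; [apply/Wb/Lx | apply: z4].
Qed.

Let z2 x y : x \in [:: u; v; - u - v] -> y \in [:: u; v; - u - v] ->
  T (z ^+ 3 * (x * y)) -> T (z ^+ 2 * (x ^+ 2 * y)).
Proof.
move=> xin yin Txy; apply: (@Tdiv 2).
have -> : z ^+ 2 * (x ^+ 2 * y) *+ 3 = y * (z ^+ 2 * (3 * z * x + 3 * x ^+ 2 + 2 * p))
    - z ^+ 3 * (x * y) *+ 3 - p * z ^+ 2 * y *+ 2 by ring.
by inT; [apply/Wg/Lx | apply: z2p].
Qed.

Let z2u3 : T (z ^+ 2 * u ^+ 3).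
Proof. by rewrite [u ^+ 3]exprSr; apply: z2 => //; rewrite -expr2; apply: z3. Qed.
Let z2v3 : T (z ^+ 2 * v ^+ 3).
Proof. by rewrite [v ^+ 3]exprSr; apply: z2 => //; rewrite -expr2; apply: z3. Qed.
Let z2u2v : T (z ^+ 2 * (u ^+ 2 * v)).
Proof. by apply: z2. Qed.
Let z2uv2 : T (z ^+ 2 * (u * v ^+ 2)).
Proof. by rewrite [u * _]mulrC; apply: z2 => //; rewrite [v * u]mulrC. Qed.

(* multiples of z: up to the quintics already reached, what remains is spanned by
   the z * q * x and the z * (p ^ 2 - x ^ 4), where
   p ^ 2 - w ^ 4 = 2 * q * u + 2 * q * v + u ^ 2 * v ^ 2 *)
Let zq x : x \in [:: u; v; - u - v] -> T (z * (q * x)).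
Proof.
move=> xin.
have -> : z * (q * x) = x * (z ^+ 4 + q * z) - z ^+ 4 * x by ring.
by inT; [apply/Wc/Lx | apply: z4].
Qed.

Let zh x : x \in [:: u; v; - u - v] -> T (z * (p ^+ 2 - x ^+ 4)).
Proof.
move=> xin; apply: (@Tdiv 3).
have -> : z * (p ^+ 2 - x ^+ 4) *+ 4 =
   z * (4 * (p ^+ 2 - x ^+ 4) + 4 * p * x * z + 5 * q * z)
   - (p * z ^+ 2 * x) *+ 4 - z ^+ 2 * q *+ 5 by ring.
have -> : z ^+ 2 * q = - (z ^+ 2 * (u ^+ 2 * v)) - z ^+ 2 * (u * v ^+ 2).
  by rewrite /q; ring.
by inT; [apply: Wh | apply: z2p].
Qed.

Let zu2v2 : T (z * (u ^+ 2 * v ^+ 2)).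
Proof.
have -> : z * (u ^+ 2 * v ^+ 2) =
  z * (p ^+ 2 - (- u - v) ^+ 4) + z * (q * (- u - v)) *+ 2 by rewrite /p /q; ring.
by inT; [apply: zh | apply: zq].
Qed.
Let zu3v : T (z * (u ^+ 3 * v)).
Proof.
have -> : z * (u ^+ 3 * v) = - (z * (q * u)) - z * (u ^+ 2 * v ^+ 2) by rewrite /q; ring.
by inT; apply: zq.
Qed.
Let zuv3 : T (z * (u * v ^+ 3)).
Proof.
have -> : z * (u * v ^+ 3) = - (z * (q * v)) - z * (u ^+ 2 * v ^+ 2) by rewrite /q; ring.
by inT; apply: zq.
Qed.
Let zu4 : T (z * u ^+ 4).
Proof.
have -> : z * u ^+ 4 = z * (p ^+ 2 - v ^+ 4) + z * (p ^+ 2 - (- u - v) ^+ 4).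
  by rewrite /p; ring.
by inT; apply: zh.
Qed.
Let zv4 : T (z * v ^+ 4).
Proof.
have -> : z * v ^+ 4 = z * (p ^+ 2 - u ^+ 4) + z * (p ^+ 2 - (- u - v) ^+ 4).
  by rewrite /p; ring.
by inT; apply: zh.
Qed.

Let zp x y : x \in [:: u; v; - u - v] -> y \in [:: u; v] -> T (z * (p * x * y)).
Proof.
have zpuu : T (z * (p * u * u)).
  have -> : z * (p * u * u) = - (z * u ^+ 4) - z * (u ^+ 3 * v) - z * (u ^+ 2 * v ^+ 2).
    by rewrite /p; ring.
  by inT.
have zpuv : T (z * (p * u * v)).
  have -> : z * (p * u * v) = - (z * (u ^+ 3 * v)) - z * (u ^+ 2 * v ^+ 2) - z * (u * v ^+ 3).
    by rewrite /p; ring.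
  by inT.
have zpvv : T (z * (p * v * v)).
  have -> : z * (p * v * v) = - (z * (u ^+ 2 * v ^+ 2)) - z * (u * v ^+ 3) - z * v ^+ 4.
    by rewrite /p; ring.
  by inT.
have zpvu : T (z * (p * v * u)) by rewrite mulrAC.
rewrite !inE => /or3P[] /eqP-> /orP[] /eqP-> //.
  have -> : z * (p * (- u - v) * u) = - (z * (p * u * u)) - z * (p * v * u) by ring.
  by inT.
have -> : z * (p * (- u - v) * v) = - (z * (p * u * v)) - z * (p * v * v) by ring.
by inT.
Qed.

(* the binary quintics: (p ^ 2 - v ^ 4) + (p ^ 2 - w ^ 4) = u ^ 4 *)
Let h x y : x \in [:: u; v; - u - v] -> y \in [:: u; v] -> T (y * (p ^+ 2 - x ^+ 4)).
Proof.
move=> xin yin; apply: (@Tdiv 3).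
have -> : y * (p ^+ 2 - x ^+ 4) *+ 4 =
   y * (4 * (p ^+ 2 - x ^+ 4) + 4 * p * x * z + 5 * q * z)
   - (z * (p * x * y)) *+ 4 - z * (q * y) *+ 5 by ring.
have yin' : y \in [:: u; v; - u - v].
  by move: yin; rewrite !inE => /orP[] ->; rewrite ?orbT.
by inT; [exact/(Wh xin)/Lx | exact: zp | exact: zq].
Qed.

Let u4 y : y \in [:: u; v] -> T (u ^+ 4 * y).
Proof.
move=> yin; have -> : u ^+ 4 * y = y * (p ^+ 2 - v ^+ 4) + y * (p ^+ 2 - (- u - v) ^+ 4).
  by rewrite /p; ring.
by inT; apply: h.
Qed.
Let v4 y : y \in [:: u; v] -> T (v ^+ 4 * y).
Proof.
move=> yin; have -> : v ^+ 4 * y = y * (p ^+ 2 - u ^+ 4) + y * (p ^+ 2 - (- u - v) ^+ 4).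
  by rewrite /p; ring.
by inT; apply: h.
Qed.

Let uin' : u \in [:: u; v]. Proof. by rewrite !inE eqxx. Qed.
Let vin' : v \in [:: u; v]. Proof. by rewrite !inE eqxx orbT. Qed.

Let u3v2 : T (u ^+ 3 * v ^+ 2).
Proof.
apply: (@Tdiv 4).
have -> : u ^+ 3 * v ^+ 2 *+ 5 =
    - (u * (p ^+ 2 - (- u - v) ^+ 4) *+ 3) + v * (p ^+ 2 - (- u - v) ^+ 4) *+ 2
    - u ^+ 4 * v *+ 6 + v ^+ 4 * u *+ 4.
  by rewrite /p; ring.
by inT; (exact: h || exact: u4 || exact: v4).
Qed.
Let u2v3 : T (u ^+ 2 * v ^+ 3).
Proof.
apply: (@Tdiv 4).
have -> : u ^+ 2 * v ^+ 3 *+ 5 =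
    - (v * (p ^+ 2 - (- u - v) ^+ 4) *+ 3) + u * (p ^+ 2 - (- u - v) ^+ 4) *+ 2
    - v ^+ 4 * u *+ 6 + u ^+ 4 * v *+ 4.
  by rewrite /p; ring.
by inT; (exact: h || exact: u4 || exact: v4).
Qed.

(** The quartics have no linear syzygy, in the effective form that every monomial
of degree 5 is a combination of their multiples by linear forms. *)
Lemma tangent_span i j k : (i + j + k = 5)%N -> T (u ^+ i * v ^+ j * z ^+ k).
Proof.
move=> ijk; rewrite mulrC.
have -> : k = (5 - i - j)%N by lia.
have : (i + j <= 5)%N by lia.
case: i {ijk} => [|[|[|[|[|[|//]]]]]];
  case: j => [|[|[|[|[|[|//]]]]]] //= _; rewrite ?expr0 ?expr1 ?mul1r ?mulr1 //;
  try (by apply: z4); try (by apply: z3).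
- by rewrite exprSr; exact: v4.
- by rewrite mulrC; exact: v4.
- exact: u4.
- by rewrite exprSr; exact: u4.
Qed.

End TangentSpan.

Lemma diff_quotient_first_order (S : comNzRingType) (u v z b0 b1 b2 b3 b4 b5 c : S) :
  let w := - u - v in let p := u * v + u * w + v * w in let q := u * v * w in
  (diff_quotient ((2 * z)%:P + c%:P * 'X)
    [:: (u - z)%:P + b0%:P * 'X; (v - z)%:P + b1%:P * 'X; (w - z)%:P + b2%:P * 'X;
        (u - 2 * z)%:P + b3%:P * 'X; (v - 2 * z)%:P + b4%:P * 'X;
        (w - 2 * z)%:P + b5%:P * 'X])`_1 =
  b0 * partial_near p q z u + b1 * partial_near p q z v + b2 * partial_near p q z w +
  b3 * partial_far p q z u + b4 * partial_far p q z v + b5 * partial_far p q z w +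
  c * partial_shift p q z.
Proof.
move=> w p q.
have e0 (a b : S) : (a%:P + b%:P * 'X)`_0 = a by rewrite coefD coefC coefMX addr0.
have e1 (a b : S) : (a%:P + b%:P * 'X)`_1 = b.
  by rewrite coefD coefC coefMX coefC add0r.
have c0 (P Q : {poly S}) : (P * Q)`_0 = P`_0 * Q`_0 by rewrite coefM big_ord1.
have c1 (P Q : {poly S}) : (P * Q)`_1 = P`_0 * Q`_1 + P`_1 * Q`_0.
  by rewrite coefM big_ord_recl big_ord1.
rewrite /= !big_cons !big_nil !(e0, e1, c0, c1, coefD, coef0, coef1) /=.
by rewrite /partial_near /partial_far /partial_shift /p /q /w; ring.
Qed.

Lemma quintic_tangent_onto (K : numFieldType) : exists M0 : 'M[K]_(7, 3),
  forall g : {mpoly K[3]}, g \is 5.-homog -> exists D, (config_pencil M0 D)`_1 = g.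
Proof.
pose u : {mpoly K[3]} := 'X_(inord 0); pose v : {mpoly K[3]} := 'X_(inord 1).
pose z : {mpoly K[3]} := 'X_(inord 2); pose w := - u - v.
pose coefs : seq (seq int) := [:: [:: 0; 0; 2];
  [:: 1; 0; -1]; [:: 0; 1; -1]; [:: -1; -1; -1];
  [:: 1; 0; -2]; [:: 0; 1; -2]; [:: -1; -1; -2]].
pose M0 : 'M[K]_(7, 3) := \matrix_(i, k) (nth 0 (nth [::] coefs i) k)%:~R.
have rowE (i : 'I_7) : let c := nth [::] coefs i in
    lform (row i M0) = (c`_0%N)%:~R *: u + (c`_1)%:~R *: v + (c`_2)%:~R *: z.
  by rewrite /lform sum3E !mxE !inordK.
have redE k : (k < 6)%N -> let c := nth [::] coefs k.+1 in
    lform (red M0 (inord k)) = (c`_0%N)%:~R *: u + (c`_1)%:~R *: v + (c`_2)%:~R *: z.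
  by move=> lt_k; rewrite /red rowE /= /bump /= inordK.
have enum6 : enum 'I_6 = [:: inord 0; inord 1; inord 2; inord 3; inord 4; inord 5].
  by apply: (inj_map val_inj); rewrite val_enum_ord /= !inordK.
have simpl := (mulr1z, mulr0z, mulrNz, scale1r, scale0r, scaleNr, addr0, add0r).
have simpl0 := (mul0r, add0r, addr0).
have two (x : {mpoly K[3]}) : (2 : int)%:~R *: x = 2 * x.
  by rewrite -[2%:~R]/(2%:R) scaler_nat mulr_natl.
pose b (D : 'M[K]_(7, 3)) k := lform (red D (inord k)).
pose p := u * v + u * w + v * w; pose q := u * v * w.
(* The differential and the quartics are made opaque, as unification would
   otherwise unfold these polynomials. *)
have [slope slopeE] : {slope | forall D, slope D = (config_pencil M0 D)`_1} by eexists.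
have [A1 A1E] : {A | forall x, A x = partial_near p q z x} by eexists.
have [A2 A2E] : {A | forall x, A x = partial_far p q z x} by eexists.
have [Am AmE] : {A | A = partial_shift p q z} by eexists.
have first_order D : slope D =
  b D 0%N * A1 u + b D 1%N * A1 v + b D 2%N * A1 w +
  b D 3%N * A2 u + b D 4%N * A2 v + b D 5%N * A2 w + lform (shift D) * Am.
  rewrite !A1E !A2E AmE slopeE -diff_quotient_first_order /config_pencil enum6 [map _ _]/=.
  have -> : lform (shift M0) = 2 * z by rewrite /shift rowE /= !simpl two.
  have -> : lform (red M0 (inord 0)) = u - z by rewrite redE //= !simpl.
  have -> : lform (red M0 (inord 1)) = v - z by rewrite redE //= !simpl.
  have -> : lform (red M0 (inord 2)) = - u - v - z by rewrite redE //= !simpl.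
  have -> : lform (red M0 (inord 3)) = u - 2 * z by rewrite redE //= !simpl two.
  have -> : lform (red M0 (inord 4)) = v - 2 * z by rewrite redE //= !simpl two.
  have -> : lform (red M0 (inord 5)) = - u - v - 2 * z by rewrite redE //= !simpl two.
  by [].
exists M0 => g hg.
pose T f := exists D, slope D = f.
have rowsD (D D' : 'M[K]_(7, 3)) c : (forall k, b (c *: D + D') k = c *: b D k + b D' k) /\
    lform (shift (c *: D + D')) = c *: lform (shift D) + lform (shift D').
  by split=> [k|]; rewrite /b /red /shift linearP lformD lformZ.
have TP c f f' : T f -> T f' -> T (c *: f + f').
  move=> [D <-] [D' <-]; exists (c *: D + D'); have [bE sE] := rowsD D D' c.
  rewrite !first_order !bE sE.
  rewrite -!mul_mpolyC; move: (c%:MP) (lform (shift D)) (lform (shift D')) => c' m m'.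
  by do 6!move: (b D _) => ?; do 6!move: (b D' _) => ?; ring.
have T0 : T 0.
  exists 0; rewrite first_order /b /red /shift !raddf0.
  have -> : lform (0 : 'rV[K]_3) = 0 by apply: big1 => k _; rewrite mxE scale0r.
  by rewrite !mul0r !addr0.
have TD f1 f2 : T f1 -> T f2 -> T (f1 + f2) by rewrite -{2}[f1]scale1r; apply: TP.
have TZ c (f : {mpoly K[3]}) : T f -> T (c *: f) by move=> Tf; rewrite -[_ *: _]addr0; apply: TP.
have TN (f : {mpoly K[3]}) : T f -> T (- f) by rewrite -scaleN1r; apply: TZ.
have Tdiv n (f : {mpoly K[3]}) : T (f *+ n.+1) -> T f.
  move/(TZ n.+1%:R^-1); rewrite -scaler_nat scalerA mulVf ?scale1r //.
  by rewrite pnatr_eq0.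
pose L f := exists a : 'rV[K]_3, f = lform a.
have LX k : L 'X_k.
  exists (delta_mx 0 k); rewrite /lform (bigD1 k) //= mxE !eqxx scale1r big1 ?addr0 //.
  by move=> l ne_lk; rewrite mxE eqxx (negbTE ne_lk) scale0r.
have Lw : L (- u - v).
  have [[a ua] [a' va]] := (LX (inord 0), LX (inord 1)).
  exists ((-1) *: a + (-1) *: a').
  by rewrite lformD !lformZ -ua -va !scaleN1r.
(* moving a single line of the configuration *)
pose single (k0 : 'I_7) (a : 'rV[K]_3) : 'M[K]_(7, 3) :=
  \matrix_(k, l) if k == k0 then a 0 l else 0.
have single_row k0 a k : lform (row k (single k0 a)) = if k == k0 then lform a else 0.
  case: eqP => [->|/eqP ne]; last first.
    by apply: big1 => l _; rewrite !mxE (negbTE ne) scale0r.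
  by apply: eq_bigr => l _; rewrite !mxE eqxx.
have bT k a : (k < 6)%N -> forall j, (j < 6)%N ->
    b (single (lift ord0 (inord k)) a) j = if j == k then lform a else 0.
  move=> lt_k j lt_j; rewrite /b /red single_row (inj_eq (@lift_inj _ _)).
  by rewrite -val_eqE /= !inordK.
have sT k a : lform (shift (single (lift ord0 (inord k)) a)) = 0.
  by rewrite /shift single_row.
have spanned i j k : (i + j + k = 5)%N -> T (u ^+ i * v ^+ j * z ^+ k).
  apply: (tangent_span TD TN Tdiv (LX _) (LX _) (LX _) Lw).
  - move=> x; rewrite !inE => /or3P[] /eqP-> l [a ->]; rewrite -A1E.
    + by exists (single (lift ord0 (inord 0)) a); rewrite first_order !bT // sT /= !simpl0.
    + by exists (single (lift ord0 (inord 1)) a); rewrite first_order !bT // sT /= !simpl0.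
    + by exists (single (lift ord0 (inord 2)) a); rewrite first_order !bT // sT /= !simpl0.
  - move=> x; rewrite !inE => /or3P[] /eqP-> l [a ->]; rewrite -A2E.
    + by exists (single (lift ord0 (inord 3)) a); rewrite first_order !bT // sT /= !simpl0.
    + by exists (single (lift ord0 (inord 4)) a); rewrite first_order !bT // sT /= !simpl0.
    + by exists (single (lift ord0 (inord 5)) a); rewrite first_order !bT // sT /= !simpl0.
  move=> l [a ->]; rewrite -AmE; exists (single ord0 a).
  by rewrite first_order /b /red /shift !single_row /= !simpl0.
suff [D <-] : T g by exists D.
rewrite [g]mpolyE big_seq; apply: (big_ind T) => // m /(dhomogP _ _ _ hg) dm.
apply: TZ; move: dm; rewrite /= mdegE mpolyXE_id !big_ord_recl !big_ord0.
rewrite mulr1 mulrA addn0 addnA.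
have e (k : 'I_3) j : k = j :> nat -> k = inord j by move=> <-; rewrite inord_val.
rewrite (e (lift ord0 (lift ord0 ord0)) 2%N) // (e (lift ord0 ord0) 1%N) // (e ord0 0%N) //.
exact: spanned.
Qed.

Theorem theorem15 (R : realType) :
  exists U : set (plane_curve R[i] 5),
    [/\ zariski_open U,
        U !=set0
      & forall X : plane_curve R[i] 5, U X -> constructible X].
Proof.
have [M0 onto] := quintic_tangent_onto (R[i] : numClosedFieldType).
exact: constructible_dense onto.
Qed.
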